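(* For each integer $n\ge1$ let $\mathcal{A}_n=\{\boldsymbol{\ell}_n(\theta_s):\ s=0,\dots,\mu\}\subset[-1,1]^3$, where $\mu$ and $\{\theta_s\}$ are given by either of the two choices (i), (ii) described in the context. Then the sequence $\{\mathcal{A}_n\}$ is a Weakly Admissible Mesh for $K=[-1,1]^3$, with $C(\mathcal{A}_n)=\mathcal{O}((\log n)^3)$ as $n\to\infty$; that is, $$ \|p\|_{\infty,[-1,1]^3}\le C(\mathcal{A}_n)\,\|p\|_{\infty,\mathcal{A}_n}\quad\text{for all } p\in\mathbb{P}_n^3,\qquad C(\mathcal{A}_n)=\mathcal{O}((\log n)^3). $$
   Context: $\mathbb{P}_n^d$ denotes the space of $d$-variate polynomials of total degree not exceeding $n$, and $\|f\|_{\infty,X}$ is the sup-norm of a function $f$ bounded on the set $X$. A Weakly Admissible Mesh (WAM) of a polynomial-determining compact set $K\subset\mathbb{R}^d$ is a sequence of finite subsets $\mathcal{A}_n\subset K$ such that $\|p\|_{\infty,K}\le C(\mathcal{A}_n)\|p\|_{\infty,\mathcal{A}_n}$ for all $p\in\mathbb{P}_n^d$, where both the constants $C(\mathcal{A}_n)$ and the cardinalities $\mathrm{card}(\mathcal{A}_n)$ increase at most polynomially with $n$. For each integer $n\ge1$, the integer triple $(a_n,b_n,c_n)$ is $$ (a_n,b_n,c_n)=\begin{cases} \left(\frac{3}{4}n^2+\frac{1}{2}n,\ \frac{3}{4}n^2+n,\ \frac{3}{4}n^2+\frac{3}{2}n+1\right), & n \text{ even},\\[4pt] \left(\frac{3}{4}n^2+\frac{1}{4},\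 \frac{3}{4}n^2+\frac{3}{2}n-\frac{1}{4},\ \frac{3}{4}n^2+\frac{3}{2}n+\frac{3}{4}\right), & n \text{ odd}, \end{cases} $$ the Lissajous curve is $\boldsymbol{\ell}_n(\theta)=(\cos(a_n\theta),\cos(b_n\theta),\cos(c_n\theta))$, $\theta\in[0,\pi]$, and $\nu=n\max\{a_n,b_n,c_n\}$. The two choices of sampling angles are: (i) $\mu=\nu$, $\theta_s=\frac{(2s+1)\pi}{2\mu+2}$, $s=0,\dots,\mu$; (ii) $\mu=\nu+1$, $\theta_s=\frac{s\pi}{\mu}$, $s=0,\dots,\mu$. *)

(* Defs.v *)
From HB Require Import structures.
From mathcomp Require Import all_boot all_order all_algebra.
From mathcomp Require Import finmap.
From mathcomp Require Import all_classical all_reals all_analysis.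
From mathcomp Require Import ring zify.
From mathcomp Require Import -(notations) mpoly.

Set Implicit Arguments.
Unset Strict Implicit.
Unset Printing Implicit Defensive.

Import Order.TTheory GRing.Theory Num.Theory.
Import numFieldNormedType.Exports.

Local Open Scope classical_set_scope.
Local Open Scope ring_scope.

Section WeaklyAdmissibleMesh.
Context {R : realType} {d : nat}.

Definition peval (p : mpoly d R) (x : 'rV[R]_d) : R :=
  meval (fun i => x ord0 i) p.

(* [msize p] is the total degree of [p] plus one (and 0 if [p = 0]). *)
Definition total_degree_le (n : nat) (p : mpoly d R) : Prop :=
  (msize p <= n.+1)%N.

(* [sup] is only meaningful on nonempty sets bounded above; [f] is meant to be
   bounded on [X], and the norm is 0 when [X] is empty. *)
Definition sup_norm (X : set 'rV[R]_d) (f : 'rV[R]_d -> R) : R :=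
  sup [set `|f x| | x in X].

Definition polynomial_determining (K : set 'rV[R]_d) : Prop :=
  forall p : mpoly d R, (forall x, K x -> peval p x = 0) -> p = 0.

(* For sequences indexed by n >= 1. *)
Definition at_most_polynomial (u : nat -> R) : Prop :=
  exists (M : R) (k : nat), forall n, (0 < n)%N -> u n <= M * n%:R ^+ k.

(* The meshes are indexed by n >= 1; the values of [A] and [C] at 0 play no
   role. *)
Record is_WAM (K : set 'rV[R]_d) (A : nat -> {fset 'rV[R]_d})
    (C : nat -> R) : Prop := IsWAM {
  WAM_compact : compact K;
  WAM_determining : polynomial_determining K;
  WAM_sub : forall n, (0 < n)%N -> [set` A n] `<=` K;
  WAM_ineq : forall n, (0 < n)%N -> forall p : mpoly d R,
    total_degree_le n p ->
    sup_norm K (peval p) <= C n * sup_norm [set` A n] (peval p);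
  WAM_const_growth : at_most_polynomial C;
  WAM_card_growth : at_most_polynomial (fun n => (#|` A n|)%:R) }.

End WeaklyAdmissibleMesh.

(* All divisions by 4 below are exact, and the subtraction is not truncated
   when n >= 1: see [freqE_even] and [freqE_odd]. *)
Definition freq_a (n : nat) : nat :=
  (if odd n then (3 * n ^ 2 + 1) %/ 4 else (3 * n ^ 2 + 2 * n) %/ 4)%N.
Definition freq_b (n : nat) : nat :=
  (if odd n then (3 * n ^ 2 + 6 * n - 1) %/ 4
   else (3 * n ^ 2 + 4 * n) %/ 4)%N.
Definition freq_c (n : nat) : nat :=
  (if odd n then (3 * n ^ 2 + 6 * n + 3) %/ 4
   else (3 * n ^ 2 + 6 * n + 4) %/ 4)%N.

Lemma freqE_even n : ~~ odd n ->
  [/\ (freq_a n)%:Q = 3 / 4 * n%:Q ^+ 2 + 1 / 2 * n%:Q,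
      (freq_b n)%:Q = 3 / 4 * n%:Q ^+ 2 + n%:Q &
      (freq_c n)%:Q = 3 / 4 * n%:Q ^+ 2 + 3 / 2 * n%:Q + 1].
Proof.
move=> /negbTE n_even; rewrite /freq_a /freq_b /freq_c n_even.
rewrite -[n]odd_double_half n_even add0n -mul2n; move: n./2 => k.
have -> : ((3 * (2 * k) ^ 2 + 2 * (2 * k)) %/ 4 = 3 * k ^ 2 + k)%N by lia.
have -> : ((3 * (2 * k) ^ 2 + 4 * (2 * k)) %/ 4 = 3 * k ^ 2 + 2 * k)%N by lia.
have -> : ((3 * (2 * k) ^ 2 + 6 * (2 * k) + 4) %/ 4 = 3 * k ^ 2 + 3 * k + 1)%N
  by lia.
by split; field.
Qed.

Lemma freqE_odd n : odd n ->
  [/\ (freq_a n)%:Q = 3 / 4 * n%:Q ^+ 2 + 1 / 4,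
      (freq_b n)%:Q = 3 / 4 * n%:Q ^+ 2 + 3 / 2 * n%:Q - 1 / 4 &
      (freq_c n)%:Q = 3 / 4 * n%:Q ^+ 2 + 3 / 2 * n%:Q + 3 / 4].
Proof.
move=> n_odd; rewrite /freq_a /freq_b /freq_c n_odd.
rewrite -[n]odd_double_half n_odd add1n -mul2n; move: n./2 => k.
have -> : ((3 * (2 * k).+1 ^ 2 + 1) %/ 4 = 3 * k ^ 2 + 3 * k + 1)%N by lia.
have -> : ((3 * (2 * k).+1 ^ 2 + 6 * (2 * k).+1 - 1) %/ 4
           = 3 * k ^ 2 + 6 * k + 2)%N by lia.
have -> : ((3 * (2 * k).+1 ^ 2 + 6 * (2 * k).+1 + 3) %/ 4
           = 3 * k ^ 2 + 6 * k + 3)%N by lia.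
by split; field.
Qed.

Definition nu (n : nat) : nat :=
  (n * maxn (freq_a n) (maxn (freq_b n) (freq_c n)))%N.

(* The two choices of sampling angles: zeros, respectively extrema including
   endpoints, of a Chebyshev polynomial in the variable cos(theta). *)
Variant sampling := ChebyshevZeros | ChebyshevExtrema.

Definition mu (c : sampling) (n : nat) : nat :=
  match c with
  | ChebyshevZeros => nu n
  | ChebyshevExtrema => (nu n).+1
  end.

Section LissajousMesh.
Context {R : realType}.

Definition theta (c : sampling) (n s : nat) : R :=
  match c with
  | ChebyshevZeros => (2 * s + 1)%:R * pi / (2 * mu c n + 2)%:R
  | ChebyshevExtrema => s%:R * pi / (mu c n)%:R
  end.

Definition lissajous (n : nat) (t : R) : 'rV[R]_3 :=
  \row_(i < 3) nth 0 [:: cos ((freq_a n)%:R * t);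
                         cos ((freq_b n)%:R * t);
                         cos ((freq_c n)%:R * t)] i.

Definition lissajous_mesh (c : sampling) (n : nat) : {fset 'rV[R]_3} :=
  [fset lissajous n (theta c n (nat_of_ord s)) | s in 'I_(mu c n).+1]%fset.

Definition cube : set 'rV[R]_3 := [set x | forall i, -1 <= x ord0 i <= 1].

End LissajousMesh.

(* Main.v *)
Require Import Defs.
From mathcomp Require Import all_boot all_order all_algebra.
From mathcomp Require Import finmap.
From mathcomp Require Import all_classical all_reals all_analysis.
From mathcomp Require Import -(notations) mpoly.
From mathcomp Require Import complex ring lra zify.

(** A polynomial p of degree at most n on the cube, read through x_i = cos t_i,
    is a Laurent polynomial P in z_i = e^(i t_i) with frequencies in the
    octahedron |k_1| + |k_2| + |k_3| <= n.  On the curve it is sampled at K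
    equally spaced angles of the full circle (by evenness, all these samples
    lie in the mesh), and since no nonzero frequency of the octahedron of
    radius 2n is sent to 0 modulo K by (a_n, b_n, c_n), the sampling rule
    integrates every such frequency exactly.  Hence P is reproduced by discrete
    convolution with the octahedral Dirichlet kernel, whose discrete L1 norm
    has to be bounded by O((log n)^3).

    The octahedron is cut into eight simplices; on each of them the kernel is,
    up to a unit factor, a complete homogeneous symmetric polynomial of the four
    points w_1, w_2, w_3, 1 of the unit circle.  Its divided difference
    recurrence bounds it by a sum, over a few spanning trees on the four points,
    of products of G(w/w') over the three edges, for any G >= 0 such that
    G(z) >= min(Lambda, 1/|z - 1|).  For G take a multiple of the sum of the
    Fejer kernels of orders 1, 2, 4, ..., 2^L with 2^L about n/3: these products
    are then nonnegative Laurent polynomials of degree at most 2n, so that their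
    discrete mean is exactly the cube of the mean of G, which is O(log n). *)

Set Implicit Arguments.
Unset Strict Implicit.
Unset Printing Implicit Defensive.

Import Order.TTheory GRing.Theory Num.Theory.
Import numFieldNormedType.Exports.

Local Open Scope classical_set_scope.
Local Open Scope ring_scope.

(** * Frequencies *)

(* The integer solutions form the lattice of the (i, j, k) with
   i = (3m+2)S + (m+1)r, j = -(3m+1)S - (2m+1)r, k = mr; the norm bound leaves
   finitely many pairs (r, S) to be tested.  The odd case is similar, with a
   reduced basis. *)
Lemma lattice_even (m i j k : int) : 0 < m ->
  i * (3 * m * m + m) + j * (3 * m * m + 2 * m)
    + k * (3 * m * m + 3 * m + 1) = 0 ->
  `|i| + `|j| + `|k| <= 4 * m -> [/\ i = 0, j = 0 & k = 0].
Proof.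
move=> m0 eq0 le4; suff: i = 0 /\ j = 0 /\ k = 0 by case=> ? [].
have [r kE] : exists r, k = m * r.
  (* The equation reads m (3m (i + j + k) + i + 2j + 3k) + k = 0. *)
  exists (- (3 * m * (i + j + k) + (i + 2 * j + 3 * k))).
  by apply/eqP; rewrite -subr_eq0; apply/eqP; rewrite -[RHS]eq0; ring.
have jE : j = - (3 * m + 1) * (i + j + k) - (2 * m + 1) * r.
  have mN0 : m != 0 by lia.
  apply: (mulfI mN0); apply/eqP; rewrite -subr_eq0; apply/eqP.
  by rewrite -[RHS]eq0 kE; ring.
have [S SE] : exists S, S = i + j + k by eexists.
rewrite -SE in jE.
have iE : i = (3 * m + 2) * S + (m + 1) * r.
  transitivity (S - j - k); first by rewrite SE; ring.
  by rewrite jE kE; ring.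
have SE' : (3 * m + 2) * S = i - k - r by rewrite iE kE; ring.
have r4 : (-4 <= r <= 4) by apply/andP; split; rewrite -(ler_pM2l m0) -kE; lia.
have m2 : 0 < 3 * m + 2 by lia.
have S2 : (-2 <= S <= 2) by apply/andP; split; rewrite -(ler_pM2l m2) SE'; lia.
have rd : r \in [:: -4; -3; -2; -1; 0; 1; 2; 3; 4 : int] by rewrite !inE; lia.
have Sd : S \in [:: -2; -1; 0; 1; 2 : int] by rewrite !inE; lia.
clear eq0 SE SE' r4 S2.
move: rd; rewrite !inE => /or4P[||| /or4P[||| /or3P[]]] /eqP rE;
  move: Sd; rewrite !inE => /or4P[||| /orP[]] /eqP SE;
  by subst r S; lia.
Qed.

Lemma lattice_odd (m i j k : int) : 0 <= m ->
  i * (3 * m * m + 3 * m + 1) + j * (3 * m * m + 6 * m + 2)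
    + k * (3 * m * m + 6 * m + 3) = 0 ->
  `|i| + `|j| + `|k| <= 4 * m + 2 -> [/\ i = 0, j = 0 & k = 0].
Proof.
move=> m0 eq0 le4; suff: i = 0 /\ j = 0 /\ k = 0 by case=> ? [].
have [S SE] : exists S, S = i + j + k by eexists.
(* In the coordinates S, t the solutions are S (m+1, m+1, -(2m+1)) + t (1, -(3m+2), 3m+1). *)
have [t tE] : exists t, t = i - (m + 1) * S by eexists.
have iE : i = (m + 1) * S + t by rewrite tE; ring.
have kE : k = - (2 * m + 1) * S + (3 * m + 1) * t.
  by apply/eqP; rewrite -subr_eq0; apply/eqP; rewrite -[RHS]eq0 tE SE; ring.
have jE : j = (m + 1) * S - (3 * m + 2) * t.
  transitivity (S - i - k); first by rewrite SE; ring.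
  by rewrite iE kE; ring.
have tE' : (3 * m + 3) * t = i - j by rewrite iE jE; ring.
have SE' : (m + 1) * S = i - t by rewrite iE; ring.
have m3 : 0 < 3 * m + 3 by lia.
have t2 : (-2 < t < 2) by apply/andP; split; rewrite -(ltr_pM2l m3) tE'; lia.
have m1 : 0 < m + 1 by lia.
have S2 : (-4 < S < 4) by apply/andP; split; rewrite -(ltr_pM2l m1) SE'; lia.
have td : t \in [:: -1; 0; 1 : int] by rewrite !inE; lia.
have Sd : S \in [:: -3; -2; -1; 0; 1; 2; 3 : int] by rewrite !inE; lia.
clear eq0 SE SE' tE' t2 S2 tE.
move: td; rewrite !inE => /or3P[] /eqP tE;
  move: Sd; rewrite !inE => /or4P[||| /or4P[]] /eqP SE;
  by subst t S; lia.
Qed.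

(** Non-resonance at radius 2n, where the differences of two frequencies of the octahedron of radius
    n lie. The parity of n selects one of the two lattices. *)
Lemma freq_free n (i j k : int) : (0 < n)%N ->
  (`|i| + `|j| + `|k| <= 2 * n)%N ->
  i * (freq_a n)%:Z + j * (freq_b n)%:Z + k * (freq_c n)%:Z = 0 ->
  [/\ i = 0, j = 0 & k = 0].
Proof.
rewrite /freq_a /freq_b /freq_c; move: (odd_double_half n); rewrite -mul2n.
case: (odd n) => /= nE n0 le2n eq0.
  rewrite add1n in nE; rewrite -nE in n0 le2n eq0;
    move: n./2 => m in n0 le2n eq0 nE.
  apply: (@lattice_odd m%:Z); [lia| |lia].
  have aE : ((3 * (2 * m).+1 ^ 2 + 1) %/ 4 = 3 * m * m + 3 * m + 1)%N by lia.
  have bE : ((3 * (2 * m).+1 ^ 2 + 6 * (2 * m).+1 - 1) %/ 4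
           = 3 * m * m + 6 * m + 2)%N by lia.
  have cE : ((3 * (2 * m).+1 ^ 2 + 6 * (2 * m).+1 + 3) %/ 4
           = 3 * m * m + 6 * m + 3)%N by lia.
  by rewrite -[RHS]eq0 aE bE cE !PoszD !PoszM.
rewrite add0n in nE; rewrite -nE in n0 le2n eq0;
    move: n./2 => m in n0 le2n eq0 nE.
apply: (@lattice_even m%:Z); [lia| |lia].
have aE : ((3 * (2 * m) ^ 2 + 2 * (2 * m)) %/ 4 = 3 * m * m + m)%N by lia.
have bE : ((3 * (2 * m) ^ 2 + 4 * (2 * m)) %/ 4 = 3 * m * m + 2 * m)%N by lia.
have cE : ((3 * (2 * m) ^ 2 + 6 * (2 * m) + 4) %/ 4 = 3 * m * m + 3 * m + 1)%N
  by lia.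
by rewrite -[RHS]eq0 aE bE cE !PoszD !PoszM.
Qed.

Lemma freq_le n : [/\ (freq_a n <= 4 * n ^ 2 + 1)%N,
  (freq_b n <= 4 * n ^ 2 + 1)%N & (freq_c n <= 4 * n ^ 2 + 1)%N].
Proof. by split; rewrite /freq_a /freq_b /freq_c; case: odd; nia. Qed.

(** * Complete homogeneous polynomials *)

Section CompleteHomogeneous.
Variable C : comRingType.
Implicit Types (x y : C) (W : seq C) (N : nat).

Fixpoint hsym W N : C :=
  if W is x :: W' then \sum_(i < N.+1) x ^+ i * hsym W' (N - i)
  else (N == 0)%:R.

Lemma hsym_cons0 x W : hsym (x :: W) 0 = hsym W 0.
Proof. by rewrite /= big_ord1 expr0 mul1r. Qed.

Lemma hsym_consS x W N : hsym (x :: W) N.+1 = hsym W N.+1 + x * hsym (x :: W) N.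
Proof.
rewrite /= big_ord_recl expr0 mul1r subn0 mulr_sumr; congr (_ + _).
by apply: eq_bigr => i _; rewrite exprS mulrA.
Qed.

(** The divided difference recurrence: multiplication by x - y removes a point at the cost of one
    more degree. *)
Lemma hsym_diff x y W N :
  (x - y) * hsym [:: x, y & W] N = hsym (x :: W) N.+1 - hsym (y :: W) N.+1.
Proof.
elim: N => [|N IHN].
  by rewrite !hsym_cons0 !hsym_consS !hsym_cons0; ring.
rewrite (hsym_consS x [:: y & W]) mulrDr mulrCA IHN.
by rewrite (hsym_consS x W N.+1) (hsym_consS y W N.+1); ring.
Qed.

Lemma hsym1 x N : hsym [:: x] N = x ^+ N.
Proof.
by elim: N => [|N IHN]; rewrite ?hsym_cons0 // hsym_consS IHN exprS add0r.
Qed.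

Lemma hsym_cons_widen x W N n : (N <= n)%N ->
  hsym (x :: W) N = \sum_(i < n.+1 | (i <= N)%N) x ^+ i * hsym W (N - i).
Proof.
move=> leNn.
by rewrite /= (big_ord_widen n.+1 (fun i => x ^+ i * hsym W (N - i))).
Qed.

(** The variable 1 absorbs the slack n - d - i - j - l, which makes the sum over a simplex
    homogeneous of degree n - d. In the application, d counts the negative signs of an octant. *)
Lemma hsym_simplex w1 w2 w3 n d :
  \sum_(i < n.+1) \sum_(j < n.+1) \sum_(l < n.+1 | (i + j + l + d <= n)%N)
     w1 ^+ i * w2 ^+ j * w3 ^+ l
  = if (d <= n)%N then hsym [:: w1; w2; w3; 1] (n - d) else 0.
Proof.
case: leqP => [le_dn|lt_nd]; last first.
  by rewrite big1 // => i _; rewrite big1 // => j _; rewrite big1 // => l; lia.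
rewrite (hsym_cons_widen _ _ (leq_subr d n)) [RHS]big_mkcond;
  apply: eq_bigr => i _.
case: ifP => [le_i|gt_i]; last first.
  by rewrite big1 // => j _; rewrite big1 // => l; lia.
rewrite (@hsym_cons_widen _ _ _ n); last by lia.
rewrite mulr_sumr [RHS]big_mkcond; apply: eq_bigr => j _.
case: ifP => [le_j|gt_j]; last by rewrite big1 // => l; lia.
rewrite (@hsym_cons_widen _ _ _ n); last by lia.
rewrite !mulr_sumr; apply: eq_big => [l|l _]; first by apply/idP/idP; lia.
by rewrite hsym1 expr1n mulr1 mulrA.
Qed.
End CompleteHomogeneous.

(** * Bounds for complete homogeneous polynomials on the unit circle *)

Section TreeBound.
Variables (C : numFieldType) (G : C -> C) (Lam : nat).
Hypothesis G_ge0 : forall z, 0 <= G z.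
Hypothesis G_large : forall z, `|z| = 1 -> Lam%:R <= G z \/ 1 <= G z * `|z - 1|.

(* Unfolded, a sum over spanning trees of the point set x :: W of products of
   [G] over the edges (with multiplicities). *)
Fixpoint tree_bound (x : C) (W : seq C) : C :=
  if W is y :: W' then G (x / y) * (tree_bound x W' + tree_bound y W') else 1.

Lemma tree_bound_ge0 x W : 0 <= tree_bound x W.
Proof. by elim: W x => //= y W IHW x; rewrite mulr_ge0 // addr_ge0. Qed.

(* If [G (x / y) >= Lam], sum trivially over the powers of x; otherwise divide
   by x - y, which lowers the number of points by one. *)
Lemma hsym_bound (x : C) (W : seq C) N :
  all (fun y => `|y| == 1) (x :: W) -> (N + size W < Lam)%N ->
  `|hsym (x :: W) N| <= tree_bound x W.
Proof.
elim: W x N => [|y W IHW] x N /=.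
  by rewrite andbT => /eqP x1 _; rewrite -[X in `|X|]/(hsym [:: x] N) hsym1
    normrX x1 expr1n.
move=> /and3P[/eqP x1 /eqP y1 W1] ltN.
have y0 : y != 0 by rewrite -normr_gt0 y1.
have IHx M : (M <= N.+1)%N -> `|hsym (x :: W) M| <= tree_bound x W.
  by move=> leM; apply: IHW; [rewrite /= x1 eqxx|lia].
have IHy M : (M <= N.+1)%N -> `|hsym (y :: W) M| <= tree_bound y W.
  by move=> leM; apply: IHW; [rewrite /= y1 eqxx|lia].
have [|G_Lam|G_far] := @G_large (x / y); first by rewrite normf_div x1 y1 divr1.
  rewrite -[X in `|X|]/(hsym [:: x, y & W] N).
  rewrite -[hsym _ _]/(\sum_(i < N.+1) x ^+ i * hsym (y :: W) (N - i)).
  apply: le_trans (ler_norm_sum _ _ _) _.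
  apply: (@le_trans _ _ (\sum_(i < N.+1) tree_bound y W)).
    by apply: ler_sum => i _; rewrite normrM normrX x1 expr1n mul1r IHy //; lia.
  rewrite sumr_const card_ord -mulr_natl; apply: ler_pM;
    rewrite ?ler0n ?tree_bound_ge0 //.
    by apply: le_trans G_Lam; rewrite ler_nat; lia.
  by rewrite lerDr tree_bound_ge0.
have dxy : `|x / y - 1| = `|x - y|.
  by rewrite (_ : x / y - 1 = (x - y) / y) ?normf_div ?y1 ?divr1 // mulrBl
    divff.
have gt0 : 0 < `|x - y|.
  rewrite lt_neqAle normr_ge0 andbT eq_sym; apply/eqP => d0.
  by move: G_far; rewrite dxy d0 mulr0 ler10.
rewrite -(ler_pM2l gt0) -normrM.
rewrite -[X in `|X|]/((x - y) * hsym [:: x, y & W] N) hsym_diff.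
apply: le_trans (ler_normB _ _) _.
apply: le_trans (lerD (IHx _ (leqnn _)) (IHy _ (leqnn _))) _.
rewrite mulrA mulrC ler_peMr ?addr_ge0 ?tree_bound_ge0 //.
by rewrite mulrC -dxy.
Qed.
End TreeBound.

(** * Dyadic sums of Fejer kernels *)

Section DyadicFejer.
Variable C : numClosedFieldType.
Implicit Types (z : C) (M L : nat).

Definition fejer M z : C := `|\sum_(j < M) z ^+ j| ^+ 2 / M%:R.

(** The factor 24 turns the bound M / 4 of [fejer_lower] into 6 * 2 ^ L, which exceeds n + 3 for the
    level L chosen later. *)
Definition dyadic_fejer L z : C := 24 * \sum_(i < L.+1) fejer (2 ^ i) z.

Lemma fejer_ge0 M z : 0 <= fejer M z.
Proof. by rewrite divr_ge0 ?exprn_ge0 ?ler0n. Qed.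

Lemma dyadic_fejer_ge0 L z : 0 <= dyadic_fejer L z.
Proof. by rewrite mulr_ge0 ?ler0n // sumr_ge0 // => i _; apply: fejer_ge0. Qed.

Lemma geometric_dist z j : `|z| = 1 -> `|z ^+ j - 1| <= j%:R * `|z - 1|.
Proof.
move=> z1; rewrite subrX1 normrM mulrC ler_wpM2r //.
apply: le_trans (ler_norm_sum _ _ _) _.
rewrite (eq_bigr (fun=> 1)) => [|i _]; last by rewrite normrX z1 expr1n.
by rewrite sumr_const card_ord.
Qed.

(** Within 1 / (2M) of 1, all powers z ^ j with j < M stay within 1/2 of 1, so that their sum has
    modulus at least M / 2. *)
Lemma fejer_lower M z : (0 < M)%N -> `|z| = 1 -> M%:R * `|z - 1| <= 1 / 2 ->
  M%:R / 4 <= fejer M z.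
Proof.
move=> M0 z1 leM.
have MR0 : 0 < M%:R :> C by rewrite ltr0n.
have half : M%:R / 2 <= `|\sum_(j < M) z ^+ j|.
  have -> : \sum_(j < M) z ^+ j = M%:R + \sum_(j < M) (z ^+ j - 1).
    by rewrite sumrB sumr_const card_ord addrCA subrr addr0.
  apply: le_trans (lerB_normD _ _).
  rewrite normr_nat lerBrDr -lerBrDl.
  have -> : M%:R - M%:R / 2 = \sum_(j < M) (1 / 2) :> C.
    by rewrite sumr_const card_ord -mulr_natl; field.
  apply: le_trans (ler_norm_sum _ _ _) _; apply: ler_sum => j _.
  apply: le_trans (geometric_dist _ z1) (le_trans _ leM).
  by rewrite ler_wpM2r // ler_nat ltnW.
rewrite /fejer ler_pdivlMr //.
have -> : M%:R / 4 * M%:R = (M%:R / 2) ^+ 2 :> C by field.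
by rewrite lerXn2r // nnegrE ?divr_ge0 ?ler0n.
Qed.

Lemma dyadic_fejerS L z :
  dyadic_fejer L.+1 z = dyadic_fejer L z + 24 * fejer (2 ^ L.+1) z.
Proof. by rewrite /dyadic_fejer big_ord_recr mulrDr. Qed.

(** Induction on L. From the first alternative: if |z - 1| <= 1 / 2 ^ (L + 2), the new kernel alone
    is at least 2 ^ (L + 1) / 4; otherwise 6 * 2 ^ L times |z - 1| is already at least 3/2. The
    second alternative persists because the kernels are nonnegative. *)
Lemma dyadic_fejer_lower L z : `|z| = 1 ->
  6 * (2 ^ L)%:R <= dyadic_fejer L z \/ 1 <= dyadic_fejer L z * `|z - 1|.
Proof.
move=> z1; elim: L => [|L [IHL|IHL]].
- left; rewrite /dyadic_fejer big_ord1 /fejer big_ord1 !expr0 normr1 expr1n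
    divr1.
  by rewrite !mulr1 ler_nat.
- have [le_half|gt_half] : (2 ^ L.+1)%:R * `|z - 1| <= 1 / 2 \/
      1 / 2 <= (2 ^ L.+1)%:R * `|z - 1|.
  + apply/orP; apply: real_leVge; first by rewrite realM ?realn ?normr_real.
    by rewrite realM ?realV ?realn.
  + left; rewrite dyadic_fejerS.
    have := fejer_lower _ z1 le_half; rewrite expn_gt0 => /(_ isT) le_fejer.
    apply: le_trans (_ : 24 * ((2 ^ L.+1)%:R / 4) <= _).
      have -> : 24 * ((2 ^ L.+1)%:R / 4) = 6 * (2 ^ L.+1)%:R :> C by field.
      by [].
    by rewrite ler_wpDl ?dyadic_fejer_ge0 // ler_pM2l ?ltr0n.
  + right; apply: le_trans (_ : 6 * (2 ^ L)%:R * `|z - 1| <= _).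
      rewrite expnS natrM in gt_half.
      have -> : 6 * (2 ^ L)%:R * `|z - 1| = 3 * (2 * (2 ^ L)%:R * `|z - 1|).
        by ring.
      apply: le_trans (_ : 3 * (1 / 2) <= _); last by rewrite ler_pM2l ?ltr0n.
      by rewrite mulrA ler_pdivlMr ?ltr0n // !mul1r mulr1 ler_nat.
    rewrite ler_wpM2r // (le_trans IHL) // dyadic_fejerS lerDl.
    by rewrite mulr_ge0 ?ler0n ?fejer_ge0.
- right; apply: (le_trans IHL); rewrite ler_wpM2r // dyadic_fejerS lerDl.
  by rewrite mulr_ge0 ?ler0n ?fejer_ge0.
Qed.
End DyadicFejer.

(* Sampling at K equally spaced angles of the circle, along a curve with
   frequencies q1, q2, q3, is exact on the frequencies of l1 norm at most d. *)
Definition alias_free (K d : nat) (q1 q2 q3 : int) : Prop :=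
  forall i j k : int, (`|i| + `|j| + `|k| <= d)%N ->
    (`|(i * q1 + j * q2 + k * q3)%R| < K)%N /\
    (i * q1 + j * q2 + k * q3 = 0 -> [/\ i = 0, j = 0 & k = 0]).

(** * Laurent polynomials on the circle and exact sampling sums *)

Section Laurent.
Variable C : numClosedFieldType.
Implicit Types (f g : C -> C) (a b c : C) (m : nat) (k : int).

(* [c] is the mean of [f] on the circle; [r] lists pairs of a coefficient and an
   exponent, and an exponent may occur several times. *)
Definition laurent m f c := exists r : seq (C * int),
  [/\ all (fun t => `|t.2| <= m)%N r,
      \sum_(t <- r | t.2 == 0) t.1 = c &
      forall z, `|z| = 1 -> f z = \sum_(t <- r) t.1 * z ^ t.2].

Lemma laurent_mono m a k : (`|k| <= m)%N ->
  laurent m (fun z => a * z ^ k) (a *+ (k == 0)).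
Proof.
move=> lekm; exists [:: (a, k)]; split=> [||z _]; rewrite ?big_seq1 //=.
  by rewrite lekm.
by rewrite big_cons big_nil /= addr0 mulrb.
Qed.

Lemma laurent0 m : laurent m (fun=> 0) 0.
Proof. by exists [::]; split=> // [|z _]; rewrite big_nil. Qed.

Lemma laurentD m f g a b : laurent m f a -> laurent m g b ->
  laurent m (fun z => f z + g z) (a + b).
Proof.
move=> [r [rm ra rf]] [s [sm sb sg]]; exists (r ++ s); split.
- by rewrite all_cat rm.
- by rewrite big_cat ra sb.
- by move=> z z1; rewrite rf // sg // big_cat.
Qed.

Lemma laurentZ m a f c : laurent m f c -> laurent m (fun z => a * f z) (a * c).
Proof.
move=> [r [rm rc rf]]; exists [seq (a * t.1, t.2) | t <- r]; split.
- by rewrite all_map.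
- by rewrite big_map /= -rc mulr_sumr.
- by move=> z z1; rewrite big_map rf // mulr_sumr; apply: eq_bigr => t _;
    rewrite mulrA.
Qed.

Lemma laurent_sum (I : Type) (s : seq I) m (F : I -> C -> C) (c : I -> C) :
  (forall i, laurent m (F i) (c i)) ->
  laurent m (fun z => \sum_(i <- s) F i z) (\sum_(i <- s) c i).
Proof.
move=> Fc; elim: s => [|i s [r [rm rc rf]]].
  have [r [rm rc rf]] := laurent0 m; exists r; split=> //; rewrite ?big_nil //.
  by move=> z z1; rewrite big_nil -rf.
have [r' [rm' rc' rf']] := laurentD (Fc i) (ex_intro _ r (And3 rm rc rf)).
exists r'; split=> //; first by rewrite big_cons -rc'.
by move=> z z1; rewrite big_cons -rf'.
Qed.

Lemma laurent_widen m m' f g c :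
  (m <= m')%N -> (forall z, `|z| = 1 -> f z = g z) ->
  laurent m f c -> laurent m' g c.
Proof.
move=> lem fg [r [rm rc rf]]; exists r; split=> // [|z z1];
  last by rewrite -fg ?rf.
by apply: sub_all rm => t /leq_trans; apply.
Qed.

Lemma unit_neq0 (z : C) : `|z| = 1 -> z != 0.
Proof. by move=> z1; rewrite -normr_gt0 z1. Qed.

(** On the circle conjugation is inversion, so the square expands into the terms z ^ (i - j) / M;
    the M diagonal ones make up the mean. *)
Lemma laurent_fejer M : (0 < M)%N -> laurent M.-1 (@fejer C M) 1.
Proof.
move=> M0; have MR : M%:R != 0 :> C by rewrite pnatr_eq0 -lt0n.
have -> : 1 = \sum_(i < M) \sum_(j < M) M%:R^-1 *+ (i%:Z - j%:Z == 0) :> C.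
  rewrite (eq_bigr (fun=> M%:R^-1)) => [|i _].
    by rewrite sumr_const card_ord -[RHS]mulr_natl mulfV.
  rewrite (bigD1 i) //= subrr eqxx mulr1n big1 ?addr0 // => j jNi.
  by rewrite subr_eq0 eqz_nat val_eqE eq_sym (negPf jNi).
apply: laurent_widen (leqnn _) _
  (laurent_sum _ (fun i => laurent_sum _ (fun j => laurent_mono _ _))).
  move=> z z1; have z0 := unit_neq0 z1.
  have zc : z^* = z^-1 by rewrite invC_norm z1 expr1n invr1 mul1r.
  rewrite /fejer normCK rmorph_sum mulr_suml mulr_suml; apply: eq_bigr => i _.
  rewrite mulr_sumr mulr_suml; apply: eq_bigr => j _.
  rewrite mulrC; congr (_ * _).
  by rewrite rmorphXn /= zc expfzDr // -exprnP -exprnN exprVn.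
by move=> i j; have := ltn_ord i; have := ltn_ord j; lia.
Qed.

Lemma laurent_dyadic_fejer L :
  laurent (2 ^ L).-1 (@dyadic_fejer C L) (24 * L.+1%:R).
Proof.
have -> : L.+1%:R = \sum_(i < L.+1) 1 :> C by rewrite sumr_const card_ord.
apply: laurentZ; apply: laurent_sum => i.
apply: laurent_widen (_ : ((2 ^ i).-1 <= _)%N) (fun z _ => erefl)
  (laurent_fejer _).
  have : (2 ^ i <= 2 ^ L)%N by rewrite leq_exp2l // -ltnS.
  by lia.
by rewrite expn_gt0.
Qed.

Lemma norm_exprz (z : C) k : `|z| = 1 -> `|z ^ k| = 1.
Proof.
move=> z1; case: k => n; first by rewrite -exprnP normrX z1 expr1n.
by rewrite NegzE -exprnN normfV normrX z1 expr1n invr1.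
Qed.

Variables (K : nat) (zeta : 'I_K -> C).
Hypothesis zeta1 : forall s, `|zeta s| = 1.
Hypothesis zeta_sum : forall k, (`|k| < K)%N ->
  \sum_s zeta s ^ k = K%:R *+ (k == 0).

(** Expanding the factors gives exponent triples of l1 norm at most 3m. By [alias_free] only the
    zero triple survives the sum over the samples, and what remains factors as the cube of the
    mean. *)
Lemma laurent_prod_mean m G (g0 : C) c1 c2 c3 (q1 q2 q3 : int) :
  laurent m G g0 ->
  `|c1| = 1 -> `|c2| = 1 -> `|c3| = 1 ->
  alias_free K (3 * m) q1 q2 q3 ->
  \sum_s G (c1 * zeta s ^ q1) * G (c2 * zeta s ^ q2) * G (c3 * zeta s ^ q3)
  = K%:R * g0 ^+ 3.
Proof.
move=> [r [/allP rm rg rG]] c11 c21 c31 q_free.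
have n1 c q s : `|c| = 1 -> `|c * zeta s ^ q| = 1.
  by move=> c1'; rewrite normrM c1' norm_exprz // mulr1.
pose T t1 t2 t3 : C := t1.1 * t2.1 * t3.1 * (c1 ^ t1.2 * c2 ^ t2.2 * c3 ^ t3.2).
transitivity (\sum_s \sum_(t1 <- r) \sum_(t2 <- r) \sum_(t3 <- r)
   T t1 t2 t3 * zeta s ^ (t1.2 * q1 + t2.2 * q2 + t3.2 * q3)).
  apply: eq_bigr => s _; rewrite !rG ?n1 // !mulr_suml; apply: eq_bigr => t1 _.
  rewrite -mulrA mulr_suml mulr_sumr; apply: eq_bigr => t2 _.
  rewrite !mulr_sumr; apply: eq_bigr => t3 _.
  have z0 := unit_neq0 (zeta1 s).
  rewrite !expfzMl !expfzDr // ![_ * q1]mulrC ![_ * q2]mulrC ![_ * q3]mulrC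
    -!exprz_exp /T.
  by ring.
rewrite exchange_big /= (_ : K%:R * g0 ^+ 3 = \sum_(t1 <- r | t1.2 == 0)
   \sum_(t2 <- r | t2.2 == 0) \sum_(t3 <- r | t3.2 == 0)
     K%:R * (t1.1 * t2.1 * t3.1)); last first.
  rewrite -rg !exprS expr0 mulr1 mulr_suml mulr_sumr; apply: eq_bigr => t1 _.
  rewrite mulr_suml !mulr_sumr; apply: eq_bigr => t2 _.
  by rewrite !mulr_sumr; apply: eq_bigr => t3 _; rewrite !mulrA.
rewrite [RHS]big_mkcond; apply: eq_big_seq => t1 t1r.
rewrite exchange_big /= (_ : (if _ then _ else _) =
   \sum_(t2 <- r) if (t1.2 == 0) && (t2.2 == 0) then
   \sum_(t3 <- r | t3.2 == 0) K%:R * (t1.1 * t2.1 * t3.1) else 0); last first.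
  by case: eqP => _ /=; [rewrite big_mkcond|rewrite big1].
apply: eq_big_seq => t2 t2r.
rewrite exchange_big /= (_ : (if _ then _ else _) =
   \sum_(t3 <- r) if [&& t1.2 == 0, t2.2 == 0 & t3.2 == 0] then
   K%:R * (t1.1 * t2.1 * t3.1) else 0); last first.
  by case: eqP => _ /=; [case: eqP => _ /=;
    [rewrite big_mkcond|rewrite big1]|rewrite big1].
apply: eq_big_seq => t3 t3r.
have [|lt_K eq0] := q_free t1.2 t2.2 t3.2.
  by have := rm _ t1r; have := rm _ t2r; have := rm _ t3r => /=; lia.
rewrite -mulr_sumr zeta_sum //.
case: (altP and3P) => [[/eqP k1 /eqP k2 /eqP k3]|kN0].
  by rewrite /T k1 k2 k3 !mul0r !addr0 eqxx mulr1n !expr0z !mulr1 mulrC.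
case: eqP => [/eq0 [k1 k2 k3]|_]; last by rewrite mulr0n mulr0.
by case/and3P: kN0; rewrite k1 k2 k3.
Qed.
End Laurent.

(** * The octahedral Dirichlet kernel *)

Section Octahedron.
Variables (C : numClosedFieldType) (n : nat).
Implicit Types (x y z w : C) (k : int) (b : bool).

(* [Negz i] is -(i+1): the octants are disjoint, each frequency is hit once. *)
Definition signed_nat b (i : nat) : int := if b then Negz i else Posz i.

Lemma signed_nat_surj k : exists b i, [/\ (i <= `|k|)%N & signed_nat b i = k].
Proof.
by case: k => i; [exists false, i|exists true, i]; split=> //;
  rewrite ?absz_nat //; lia.
Qed.

Lemma signed_nat_inj b b' i i' : signed_nat b i = signed_nat b' i' ->
  b = b' /\ i = i'.
Proof. by case: b; case: b' => //= -[->]. Qed.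

Definition octant_kernel (b : bool * bool * bool) z1 z2 z3 : C :=
  \sum_(i < n.+1) \sum_(j < n.+1)
    \sum_(l < n.+1 | (`|signed_nat b.1.1 i| + `|signed_nat b.1.2 j| +
      `|signed_nat b.2 l| <= n)%N)
     z1 ^ signed_nat b.1.1 i * z2 ^ signed_nat b.1.2 j * z3 ^ signed_nat b.2 l.

Definition octahedral_kernel z1 z2 z3 : C := \sum_b octant_kernel b z1 z2 z3.

Definition inv_if b z : C := if b then z^-1 else z.

Lemma norm_inv_if b z : `|z| = 1 -> `|inv_if b z| = 1.
Proof. by case: b => //= z1; rewrite normfV z1 invr1. Qed.

(** A negative coordinate is -(i + 1), so each negative sign releases one factor z^-1 of modulus 1;
    a simplex sum in the [inv_if b z] is left. *)
Lemma octant_kernel_bound (G : C -> C) (b : bool * bool * bool) z1 z2 z3 :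
  (forall z, 0 <= G z) ->
  (forall z, `|z| = 1 -> (n + 4)%:R <= G z \/ 1 <= G z * `|z - 1|) ->
  `|z1| = 1 -> `|z2| = 1 -> `|z3| = 1 ->
  `|octant_kernel b z1 z2 z3| <=
    tree_bound G (inv_if b.1.1 z1) [:: inv_if b.1.2 z2; inv_if b.2 z3; 1].
Proof.
move=> G_ge0 G_large z11 z21 z31; case: b => [[b1 b2] b3]; cbn [fst snd].
pose u b z := if b then z^-1 else 1 : C.
have u1 b z : `|z| = 1 -> `|u b z| = 1.
  by case: b => /= [/(norm_inv_if true) //|]; rewrite normr1.
have uE b z i : z ^ signed_nat b i = u b z * inv_if b z ^+ i.
  by case: b => /=; rewrite ?mul1r // NegzE -exprnN -exprVn exprS.
have -> : octant_kernel (b1, b2, b3) z1 z2 z3 = u b1 z1 * u b2 z2 * u b3 z3 *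
   \sum_(i < n.+1) \sum_(j < n.+1)
     \sum_(l < n.+1 | (i + j + l + (b1 + b2 + b3) <= n)%N)
      inv_if b1 z1 ^+ i * inv_if b2 z2 ^+ j * inv_if b3 z3 ^+ l.
  rewrite /octant_kernel mulr_sumr; apply: eq_bigr => i _.
  rewrite mulr_sumr; apply: eq_bigr => j _; rewrite mulr_sumr.
  apply: eq_big => [l|l _]; first by case: b1 b2 b3 => -[] [] /=; lia.
  by rewrite !uE; ring.
rewrite !normrM !u1 // !mul1r hsym_simplex; case: ifP => _; last first.
  by rewrite normr0 tree_bound_ge0.
(* The degree is at most n and three points follow the first, which stays below n + 4. *)
apply: (hsym_bound G_ge0 G_large); last by rewrite /=; lia.
by rewrite /= !norm_inv_if ?normr1 ?eqxx.
Qed.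

Variables (K : nat) (zeta : 'I_K -> C) (f1 f2 f3 : nat).
Hypothesis zeta1 : forall s, `|zeta s| = 1.
Hypothesis zeta_sum : forall k, (`|k| < K)%N ->
  \sum_s zeta s ^ k = K%:R *+ (k == 0).
Hypothesis freq_alias_free : alias_free K (2 * n) f1%:Z f2%:Z f3%:Z.

Definition reproduced (f : C -> C -> C -> C) := forall x1 x2 x3,
  `|x1| = 1 -> `|x2| = 1 -> `|x3| = 1 ->
  \sum_s f (zeta s ^ f1) (zeta s ^ f2) (zeta s ^ f3)
     * octahedral_kernel (x1 / zeta s ^ f1) (x2 / zeta s ^ f2)
         (x3 / zeta s ^ f3)
  = K%:R * f x1 x2 x3.

Lemma reproduced_ext f g :
  (forall x1 x2 x3, `|x1| = 1 -> `|x2| = 1 -> `|x3| = 1 ->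
    f x1 x2 x3 = g x1 x2 x3) ->
  reproduced f -> reproduced g.
Proof.
move=> fg rf x1 x2 x3 x11 x21 x31; rewrite -fg // -rf //.
by apply: eq_bigr => s _; rewrite fg ?norm_exprz.
Qed.

Lemma reproducedD f g : reproduced f -> reproduced g ->
  reproduced (fun x1 x2 x3 => f x1 x2 x3 + g x1 x2 x3).
Proof.
move=> rf rg x1 x2 x3 x11 x21 x31; rewrite mulrDr -rf // -rg // -big_split.
by apply: eq_bigr => s _; rewrite /= mulrDl.
Qed.

Lemma reproducedZ a f :
  reproduced f -> reproduced (fun x1 x2 x3 => a * f x1 x2 x3).
Proof.
move=> rf x1 x2 x3 x11 x21 x31; rewrite mulrCA -rf // mulr_sumr.
by apply: eq_bigr => s _; rewrite mulrA.
Qed.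

Lemma reproduced_sum (I : eqType) (r : seq I) (F : I -> C -> C -> C -> C) :
  (forall i, i \in r -> reproduced (F i)) ->
  reproduced (fun x1 x2 x3 => \sum_(i <- r) F i x1 x2 x3).
Proof.
move=> rF x1 x2 x3 x11 x21 x31; rewrite mulr_sumr.
under eq_bigr do rewrite mulr_suml.
by rewrite exchange_big; apply: eq_big_seq => i /rF ->.
Qed.

(** Against the kernel term of frequency e, the samples oscillate with frequency k - e, of norm at
    most 2n; without aliasing, only e = k contributes. *)
Lemma reproduced_mono k1 k2 k3 : (`|k1| + `|k2| + `|k3| <= n)%N ->
  reproduced (fun x1 x2 x3 => x1 ^ k1 * x2 ^ k2 * x3 ^ k3).
Proof.
move=> lekn x1 x2 x3 x11 x21 x31.
pose T (b : bool * bool * bool) (i j l : 'I_n.+1) : C :=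
  K%:R * (x1 ^ k1 * x2 ^ k2 * x3 ^ k3)
  *+ [&& signed_nat b.1.1 i == k1, signed_nat b.1.2 j == k2
       & signed_nat b.2 l == k3].
transitivity (\sum_b \sum_(i < n.+1) \sum_(j < n.+1)
    \sum_(l < n.+1 | (`|signed_nat b.1.1 i| + `|signed_nat b.1.2 j| +
      `|signed_nat b.2 l| <= n)%N)
    T b i j l).
  rewrite (eq_bigr _ (fun s _ => mulr_sumr _ _ _ _)) exchange_big;
    apply: eq_bigr => b _.
  rewrite (eq_bigr _ (fun s _ => mulr_sumr _ _ _ _)) exchange_big;
    apply: eq_bigr => i _.
  rewrite (eq_bigr _ (fun s _ => mulr_sumr _ _ _ _)) exchange_big;
    apply: eq_bigr => j _.
  rewrite (eq_bigr _ (fun s _ => mulr_sumr _ _ _ _)) exchange_big;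
    apply: eq_bigr => l leijl.
  rewrite /T; move: (signed_nat b.1.1 i) (signed_nat b.1.2 j)
    (signed_nat b.2 l) leijl => e1 e2 e3 leijl.
  transitivity (\sum_s x1 ^ e1 * x2 ^ e2 * x3 ^ e3 *
     zeta s ^ ((k1 - e1) * f1%:Z + (k2 - e2) * f2%:Z + (k3 - e3) * f3%:Z)).
    apply: eq_bigr => s _; have z0 := unit_neq0 (zeta1 s).
    rewrite !expfzMl !exprz_inv !expfzDr // ![(_ - _) * _]mulrC -!exprz_exp.
    by rewrite !expfzDr ?expf_neq0 // -!exprnP; ring.
  have le2n : (`|(k1 - e1)%R| + `|(k2 - e2)%R| + `|(k3 - e3)%R| <= 2 * n)%N.
    by lia.
  have [lt_K eq0] := freq_alias_free le2n; rewrite -mulr_sumr zeta_sum //.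
  case: (altP and3P) => [[/eqP-> /eqP-> /eqP->]|kNe].
    by rewrite !subrr eqxx !mulr1n mulrC.
  case: eqP => [/eq0[d1 d2 d3]|_]; last by rewrite !mulr0n mulr0.
  case/and3P: kNe; split; apply/eqP; lia.
(* The octants being disjoint, exactly one term of the fourfold sum carries the frequency (k1, k2,
   k3). *)
have [b1 [i [lei bi]]] := signed_nat_surj k1.
have [b2 [j [lej bj]]] := signed_nat_surj k2.
have [b3 [l [lel bl]]] := signed_nat_surj k3.
have [ltin ltjn ltln] : [/\ (i < n.+1)%N, (j < n.+1)%N & (l < n.+1)%N].
  by split; lia.
rewrite (big_only1 (b1, b2, b3)) //=; last first.
  move=> [[b1' b2'] b3'] bNb _; rewrite big1 // => i' _;
    rewrite big1 // => j' _.
  rewrite big1 // => l' _; rewrite /T /=;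
    case: and3P => // -[/eqP bi' /eqP bj' /eqP bl'].
  case/eqP: bNb; rewrite -bi' -bj' -bl' in bi bj bl.
  by rewrite (signed_nat_inj bi).1 (signed_nat_inj bj).1 (signed_nat_inj bl).1.
rewrite (big_only1 (Ordinal ltin)) //=; last first.
  move=> i' iNi _; rewrite big1 // => j' _; rewrite big1 // => l' _.
  rewrite /T /=; case: and3P => // -[/eqP bi' _ _]; case/eqP: iNi;
    apply: val_inj.
  by rewrite -bi' in bi; rewrite /= (signed_nat_inj bi).2.
rewrite (big_only1 (Ordinal ltjn)) //=; last first.
  move=> j' jNj _; rewrite big1 // => l' _.
  rewrite /T /=; case: and3P => // -[_ /eqP bj' _]; case/eqP: jNj;
    apply: val_inj.
  by rewrite -bj' in bj; rewrite /= (signed_nat_inj bj).2.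
rewrite (big_only1 (Ordinal ltln)) //=.
- by rewrite /T /= bi bj bl !eqxx.
- by rewrite bi bj bl.
move=> l' lNl _; rewrite /T /=; case: and3P => // -[_ _ /eqP bl'].
case/eqP: lNl; apply: val_inj; rewrite -bl' in bl.
by rewrite /= (signed_nat_inj bl).2.
Qed.

Definition cosz x : C := (x + x^-1) / 2.

Lemma reproduced_cosz a1 a2 a3 : (a1 + a2 + a3 <= n)%N ->
  reproduced (fun x1 x2 x3 => cosz x1 ^+ a1 * cosz x2 ^+ a2 * cosz x3 ^+ a3).
Proof.
(* The monomial factor makes the induction possible: expanding one [cosz] moves an exponent by 1 and
   uses up one unit of degree. *)
move=> le_n; suff R k1 k2 k3 : (`|k1| + `|k2| + `|k3| + a1 + a2 + a3 <= n)%N ->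
    reproduced (fun x1 x2 x3 => x1 ^ k1 * x2 ^ k2 * x3 ^ k3 *
       (cosz x1 ^+ a1 * cosz x2 ^+ a2 * cosz x3 ^+ a3)).
  by apply: reproduced_ext (R 0 0 0 le_n) => *; rewrite !expr0z !mul1r.
have zD x k : `|x| = 1 ->
    (x ^ (k + 1) = x ^ k * x) * (x ^ (k - 1) = x ^ k * x^-1).
  by move=> /unit_neq0 x0; rewrite !expfzDr.
elim: a1 k1 k2 k3 {le_n} => [|a1 IHa] k1 k2 k3 le_n; last first.
  apply: reproduced_ext (reproducedZ 2^-1 (reproducedD (IHa (k1 + 1) k2 k3 _)
    (IHa (k1 - 1) k2 k3 _))); try lia.
  move=> x1 x2 x3 x11 x21 x31; rewrite !zD // !exprS [in RHS]/cosz; ring.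
elim: a2 k1 k2 k3 le_n => [|a2 IHa] k1 k2 k3 le_n; last first.
  apply: reproduced_ext (reproducedZ 2^-1 (reproducedD (IHa k1 (k2 + 1) k3 _)
    (IHa k1 (k2 - 1) k3 _))); try lia.
  move=> x1 x2 x3 x11 x21 x31; rewrite !zD // !exprS [in RHS]/cosz; ring.
elim: a3 k1 k2 k3 le_n => [|a3 IHa] k1 k2 k3 le_n; last first.
  apply: reproduced_ext (reproducedZ 2^-1 (reproducedD (IHa k1 k2 (k3 + 1) _)
    (IHa k1 k2 (k3 - 1) _))); try lia.
  move=> x1 x2 x3 x11 x21 x31; rewrite !zD // !exprS [in RHS]/cosz; ring.
apply: reproduced_ext (reproduced_mono (_ : (`|k1| + `|k2| + `|k3| <= n)%N));
  last by lia.
by move=> *; rewrite !expr0 !mulr1.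
Qed.

(** [tree_bound] unfolds into four spanning trees, each counted twice. Along the edges of a tree,
    exponents of norm at most 3m <= n become, by an injective linear change, frequencies of norm at
    most 2n in q1, q2, q3, so each tree contributes K times the cube of the mean. *)
Lemma tree_bound_mean m G (g0 : C) c1 c2 c3 (q1 q2 q3 : int) :
  laurent m G g0 -> (3 * m <= n)%N ->
  `|c1| = 1 -> `|c2| = 1 -> `|c3| = 1 ->
  alias_free K (2 * n) q1 q2 q3 ->
  \sum_s tree_bound G (c1 * zeta s ^ q1)
    [:: c2 * zeta s ^ q2; c3 * zeta s ^ q3; 1]
  = 8 * K%:R * g0 ^+ 3.
Proof.
move=> lG lemn c11 c21 c31 q_free.
pose P a1 a2 a3 p1 p2 p3 :=
  \sum_s G (a1 * zeta s ^ p1) * G (a2 * zeta s ^ p2) * G (a3 * zeta s ^ p3).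
transitivity (2 * (P (c1 / c2) (c1 / c3) c1 (q1 - q2) (q1 - q3) q1 +
  P (c1 / c2) (c1 / c3) c3 (q1 - q2) (q1 - q3) q3 +
  P (c1 / c2) (c2 / c3) c2 (q1 - q2) (q2 - q3) q2 +
  P (c1 / c2) (c2 / c3) c3 (q1 - q2) (q2 - q3) q3)).
  rewrite /P -!big_split mulr_sumr; apply: eq_bigr => s _ /=.
  have z0 := unit_neq0 (zeta1 s).
  have ratio c c' q q' :
      c * zeta s ^ q / (c' * zeta s ^ q') = c / c' * zeta s ^ (q - q').
    by rewrite expfzDr // -exprz_inv invfM exprz_inv invr_expz; ring.
  by rewrite !ratio !divr1; ring.
have n1 (x y : C) : `|x| = 1 -> `|y| = 1 -> `|x / y| = 1.
  by move=> x1 y1; rewrite normf_div x1 y1 divr1.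
rewrite /P !(laurent_prod_mean zeta1 zeta_sum lG) ?n1 //; first by ring.
- move=> k1 k2 k3 le_k; have [|lt_K eq0] := q_free k1 (k2 - k1) (k3 - k2);
    first by lia.
  have -> : k1 * (q1 - q2) + k2 * (q2 - q3) + k3 * q3
      = k1 * q1 + (k2 - k1) * q2 + (k3 - k2) * q3 by ring.
  by split=> // /eq0 [] *; split; lia.
- move=> k1 k2 k3 le_k; have [|lt_K eq0] := q_free k1 (k2 + k3 - k1) (- k2);
    first by lia.
  have -> : k1 * (q1 - q2) + k2 * (q2 - q3) + k3 * q2
      = k1 * q1 + (k2 + k3 - k1) * q2 + (- k2) * q3 by ring.
  by split=> // /eq0 [] *; split; lia.
- move=> k1 k2 k3 le_k; have [|lt_K eq0] := q_free (k1 + k2) (- k1) (k3 - k2);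
    first by lia.
  have -> : k1 * (q1 - q2) + k2 * (q1 - q3) + k3 * q3
      = (k1 + k2) * q1 + (- k1) * q2 + (k3 - k2) * q3 by ring.
  by split=> // /eq0 [] *; split; lia.
- move=> k1 k2 k3 le_k; have [|lt_K eq0] := q_free (k1 + k2 + k3) (- k1)
    (- k2); first by lia.
  have -> : k1 * (q1 - q2) + k2 * (q1 - q3) + k3 * q1
      = (k1 + k2 + k3) * q1 + (- k1) * q2 + (- k2) * q3 by ring.
  by split=> // /eq0 [] *; split; lia.
Qed.

(** The upper bound on 2 ^ L keeps the degree of the tree products low enough for their sampling
    sums to be exact; the lower bound makes [dyadic_fejer] large enough to dominate the kernel. *)
Lemma lebesgue_bound L (M : C) f x1 x2 x3 : (0 < K)%N ->
  (3 * (2 ^ L).-1 <= n)%N -> (n + 4 <= 6 * 2 ^ L)%N ->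
  reproduced f -> 0 <= M ->
  (forall s, `|f (zeta s ^ f1) (zeta s ^ f2) (zeta s ^ f3)| <= M) ->
  `|x1| = 1 -> `|x2| = 1 -> `|x3| = 1 ->
  `|f x1 x2 x3| <= 64 * (24 * L.+1%:R) ^+ 3 * M.
Proof.
move=> K0 leLn lenL rf M0 fM x11 x21 x31.
have KR0 : 0 < K%:R :> C by rewrite ltr0n.
pose G := @dyadic_fejer C L.
have G_ge0 z : 0 <= G z by exact: dyadic_fejer_ge0.
have G_large z : `|z| = 1 -> (n + 4)%:R <= G z \/ 1 <= G z * `|z - 1|.
  case/(dyadic_fejer_lower L) => [le_G|]; [left|by right].
  by apply: le_trans le_G; rewrite -natrM ler_nat.
(* The kernel is evaluated at x / [zeta s] ^ q, so the variables without inversion are those of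
   frequency -q. *)
pose sgn_freq b (q : nat) : int := if b then q%:Z else - q%:Z.
have inv_ifE b x (q : nat) s :
    inv_if b (x / zeta s ^ q) = inv_if b x * zeta s ^ sgn_freq b q.
  by case: b => /=; [rewrite invfM invrK|rewrite invr_expz].
rewrite -(ler_pM2l KR0) -{1}(normr_nat C K) -normrM -rf //.
apply: le_trans (ler_norm_sum _ _ _) _.
apply: (@le_trans _ _ (\sum_s \sum_(b : bool * bool * bool)
  M * tree_bound G (inv_if b.1.1 x1 * zeta s ^ sgn_freq b.1.1 f1)
    [:: inv_if b.1.2 x2 * zeta s ^ sgn_freq b.1.2 f2;
      inv_if b.2 x3 * zeta s ^ sgn_freq b.2 f3; 1])).
  apply: ler_sum => s _; rewrite normrM -mulr_sumr; apply: ler_pM => //.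
  apply: le_trans (ler_norm_sum _ _ _) _; apply: ler_sum => b _;
    rewrite -!inv_ifE.
  by apply: octant_kernel_bound => //; rewrite normf_div norm_exprz // divr1.
rewrite exchange_big /=.
rewrite (eq_bigr (fun=> M * (8 * K%:R * (24 * L.+1%:R) ^+ 3))).
  by rewrite sumr_const !card_prod !card_bool -mulr_natl le_eqVlt; apply/orP;
    left; apply/eqP; ring.
move=> [[b1 b2] b3] _; rewrite -mulr_sumr; congr (_ * _) => /=.
apply: tree_bound_mean (laurent_dyadic_fejer C L) leLn _ _ _ _;
  rewrite ?norm_inv_if // => i j k le2n.
have := @freq_alias_free (if b1 then i else - i) (if b2 then j else - j)
  (if b3 then k else - k).
rewrite /sgn_freq; case: b1 b2 b3 => -[] []; rewrite /= ?mulrN ?mulNr;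
  by case=> [|lt_K eq0]; [lia|split=> // /eq0 [] *; split; lia].
Qed.

End Octahedron.

(** * Nodes on the circle and on the curve *)

Section Expi.
Local Open Scope complex_scope.
Variable R : realType.
Implicit Types (t u : R).

Definition expi t : R[i] := cos t +i* sin t.

Lemma expiD t u : expi (t + u) = expi t * expi u.
Proof.
by rewrite /expi cosD sinD; apply/eqP; rewrite eq_complex /= eqxx addrC eqxx.
Qed.

Lemma expi0 : expi 0 = 1.
Proof. by rewrite /expi cos0 sin0. Qed.

Lemma norm_expi t : `|expi t| = 1.
Proof. by rewrite normc_def /= cos2Dsin2 sqrtr1. Qed.

Lemma expi_neq0 t : expi t != 0.
Proof. exact: unit_neq0 (norm_expi t). Qed.

Lemma expiN t : expi (- t) = (expi t)^-1.
Proof.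
by apply: (mulIf (expi_neq0 t)); rewrite -expiD addNr expi0 mulVf ?expi_neq0.
Qed.

Lemma expiMn t (n : nat) : expi (n%:R * t) = expi t ^+ n.
Proof.
elim: n => [|n IHn]; first by rewrite mul0r expi0.
by rewrite -addn1 natrD mulrDl mul1r expiD IHn exprD expr1.
Qed.

Lemma cosz_expi t : cosz (expi t) = (cos t)%:C.
Proof.
rewrite /cosz -expiN /expi cosN sinN; apply: (mulIf (_ : 2%:R != 0));
  first by rewrite pnatr_eq0.
rewrite divfK ?pnatr_eq0 //; apply/eqP; rewrite eq_complex /=; apply/andP;
  split; apply/eqP; ring.
Qed.

Lemma expi_neq1 t : 0 < t < pi *+ 2 -> expi t != 1.
Proof.
move=> /andP[t0 tpi]; rewrite eq_complex /= negb_and; apply/orP; left.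
rewrite (_ : t = (t / 2) *+ 2); last by rewrite -mulr_natr divfK.
have s0 : 0 < sin (t / 2) by apply: sin_gt0_pi; apply/andP; split; lra.
rewrite cos_mulr2n cos2sin2; apply/eqP; nra.
Qed.

Lemma expi2pi : expi (pi *+ 2) = 1.
Proof. by rewrite /expi cos2pi sin2pi. Qed.

Definition expi_node (K : nat) (d : R) (s : 'I_K) : R[i] :=
  expi ((s%:R + d) * (pi *+ 2 / K%:R)).

Lemma expi_nodeE K d (s : 'I_K) :
  expi_node d s = expi (d * (pi *+ 2 / K%:R)) * expi (pi *+ 2 / K%:R) ^+ s.
Proof. by rewrite /expi_node addrC mulrDl expiD (expiMn _ s). Qed.

(** For k nonzero this is a geometric sum whose ratio is a K-th root of unity, different from 1
    since |k| < K. *)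
Lemma expi_node_sum (K : nat) (d : R) (k : int) : (`|k| < K)%N ->
  \sum_(s < K) expi_node d s ^ k = K%:R *+ (k == 0) :> R[i].
Proof.
move=> ltkK; have [->|k0] := eqVneq k 0.
  by rewrite (eq_bigr (fun=> 1)) // sumr_const card_ord.
have K0 : 0 < K%:R :> R by rewrite ltr0n; lia.
pose w := expi (pi *+ 2 / K%:R) ^ k.
have wK : w ^+ K = 1.
  rewrite /w exprnP exprz_exp (mulrC k) -exprz_exp -exprnP -expiMn.
  rewrite [X in expi X]mulrC divfK ?gt_eqF //.
  by rewrite expi2pi exp1rz.
have w1 : w != 1.
  have : expi ((absz k)%:R * (pi *+ 2 / K%:R)) != 1.
    have pi2 : 0 < pi *+ 2 :> R by have := pi_gt0 R; lra.
    have k_gt0 : 0 < (absz k)%:R :> R by rewrite ltr0n absz_gt0.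
    apply: expi_neq1; rewrite mulr_gt0 ?divr_gt0 //=.
    by rewrite mulrA ltr_pdivrMr // mulrC ltr_pM2l ?ltr_nat.
  rewrite expiMn /w; case: (intP k) => [|i|i] //= ;
    rewrite -?exprnN ?abszN ?absz_nat //.
  by rewrite invr_eq1.
rewrite (eq_bigr (fun s : 'I_K => expi (d * (pi *+ 2 / K%:R)) ^ k * w ^+ s))
  => [|s _].
  rewrite -mulr_sumr (_ : \sum_(i < K) _ = 0) ?mulr0 //.
  by apply: (mulfI (_ : w - 1 != 0)); rewrite ?subr_eq0 // -subrX1 wK subrr
    mulr0.
by rewrite expi_nodeE expfzMl /w !exprnP !exprz_exp (mulrC k).
Qed.

Lemma norm_expi_node K d (s : 'I_K) : `|expi_node d s| = 1.
Proof. exact: norm_expi. Qed.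
End Expi.

(** * Sampling along the Lissajous curve *)

Section LissajousNodes.
Local Open Scope complex_scope.
Variable R : realType.
Implicit Types (t u : R) (c : sampling).

(** Completed by the reflection t -> 2 pi - t, both choices of angles become 2 (nu + 1) equally
    spaced points of the full circle, shifted by half a step for the zeros. *)
Definition node_count (n : nat) : nat := (2 * (nu n).+1)%N.
Definition node_shift c : R := if c is ChebyshevZeros then 1 / 2 else 0.
Definition node_angle c n (s : nat) : R :=
  (s%:R + node_shift c) * (pi *+ 2 / (node_count n)%:R).

Definition cos_row t1 t2 t3 : 'rV[R]_3 :=
  \row_(i < 3) nth 0 [:: cos t1; cos t2; cos t3] i.

Lemma cos_2piBn (k : nat) t : cos (k%:R * (pi *+ 2 - t)) = cos (k%:R * t).
Proof.
rewrite mulrBr addrC (mulr_natl (pi *+ 2)).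
by rewrite (periodicn (@cosD2pi R)) cosN.
Qed.

Lemma lissajous_2piB n t : lissajous n (pi *+ 2 - t) = lissajous n t.
Proof. by apply/rowP => i; rewrite !mxE !cos_2piBn. Qed.

Lemma node_angle_theta c n s : (s < node_count n)%N ->
  exists2 j, (j <= mu c n)%N &
    theta c n j = node_angle c n s \/ theta c n j = pi *+ 2 - node_angle c n s.
Proof.
rewrite /node_count => ltsK; case: c; rewrite /node_angle /node_shift /theta
  /mu /node_count.
- have KE : (2 * nu n + 2 = 2 * (nu n).+1)%N by lia.
  have [le_s|gt_s] := leqP s (nu n).
    exists s => //; left; rewrite KE natrD natrM.
    have K0 : (2 * (nu n).+1)%:R != 0 :> R by rewrite pnatr_eq0.
    by field.
  (* With K nodes, the reflection sends s + 1/2 to K - s - 1/2 = (K - s - 1) + 1/2; for the extrema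
     below it sends s to K - s. *)
  exists (2 * (nu n).+1 - s.+1)%N; first by lia.
  right; rewrite KE natrD !natrM natrB // natrM -natr1.
  have K0 : (nu n).+1%:R != 0 :> R by rewrite pnatr_eq0.
  by field.
- have [le_s|gt_s] := leqP s (nu n).+1.
    exists s => //; left; rewrite natrM addr0.
    have K0 : (nu n).+1%:R != 0 :> R by rewrite pnatr_eq0.
    by field.
  exists (2 * (nu n).+1 - s)%N; first by lia.
  right; rewrite natrB ?natrM ?addr0; last by lia.
  have K0 : (nu n).+1%:R != 0 :> R by rewrite pnatr_eq0.
  by field.
Qed.

Lemma node_in_mesh c n s : (s < node_count n)%N ->
  lissajous n (node_angle c n s) \in lissajous_mesh c n.
Proof.
move=> /(node_angle_theta c) [j lej thetaE]; apply/imfsetP => /=.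
exists (Ordinal (lej : (j < (mu c n).+1)%N)) => //=.
by case: thetaE => ->; rewrite ?lissajous_2piB.
Qed.

(* 8 octants, 4 spanning trees counted twice, and the cube of the mean of
   [dyadic_fejer L]. *)
Definition lebesgue_const (n : nat) : R :=
  64 * (24 * (trunc_log 2 (n %/ 3).+1).+1%:R) ^+ 3.

(** A combination of norm at most 2n is at most 2n times the largest frequency, that is 2 nu, below
    the 2 nu + 2 nodes. *)
Lemma freq_alias_free n : (0 < n)%N ->
  alias_free (node_count n) (2 * n) (freq_a n) (freq_b n) (freq_c n).
Proof.
move=> n0 i j k le2n; split; last exact: freq_free.
rewrite /node_count /nu.
set m := maxn _ _.
have [la lb lc] : [/\ (freq_a n <= m)%N, (freq_b n <= m)%N & (freq_c n <= m)%N].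
  by rewrite /m; split; lia.
have triangle (x y z : int) : (`|(x + y + z)%R| <= `|x| + `|y| + `|z|)%N by lia.
apply: leq_ltn_trans (triangle _ _ _) _; rewrite !abszM !absz_nat.
have := leq_mul (leqnn `|i|%N) la; have := leq_mul (leqnn `|j|%N) lb.
have := leq_mul (leqnn `|k|%N) lc; have := leq_mul le2n (leqnn m).
by rewrite !mulnDl; lia.
Qed.

(** L is the largest level with 3 (2 ^ L - 1) <= n; maximality gives 3 * 2 ^ (L + 1) >= 3 (n %/ 3 +
    2) >= n + 4. *)
Lemma trunc_log_bounds n (L := trunc_log 2 (n %/ 3).+1) :
  [/\ (3 * (2 ^ L).-1 <= n)%N, (n + 4 <= 6 * 2 ^ L)%N
    & (2 ^ L <= (n %/ 3).+1)%N].
Proof.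
have le_L : (2 ^ L <= (n %/ 3).+1)%N by apply: trunc_logP.
have := trunc_log_ltn (n %/ 3).+1 (isT : 1 < 2)%N; rewrite -/L expnS => lt_L.
by split=> //; lia.
Qed.

Lemma meval_lebesgue c n (p : mpoly 3 R) (M t1 t2 t3 : R) : (0 < n)%N ->
  total_degree_le n p -> 0 <= M ->
  (forall x, x \in lissajous_mesh c n -> `|peval p x| <= M) ->
  `|peval p (cos_row t1 t2 t3)| <= lebesgue_const n * M.
Proof.
move=> n0 degp M0 pM.
pose i0 : 'I_3 := ord0; pose i1 : 'I_3 := lift ord0 ord0.
pose i2 : 'I_3 := lift ord0 (lift ord0 ord0).
pose f (x1 x2 x3 : R[i]) : R[i] := \sum_(m <- msupp p) (mcoeff m p)%:C *
   (cosz x1 ^+ m i0 * cosz x2 ^+ m i1 * cosz x3 ^+ m i2).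
have fE u1 u2 u3 :
    f (expi u1) (expi u2) (expi u3) = (peval p (cos_row u1 u2 u3))%:C.
  rewrite /peval mevalE rmorph_sum; apply: eq_bigr => m _.
  rewrite !big_ord_recl big_ord0 !mxE /= mulr1 !cosz_expi.
  by rewrite !rmorphM !rmorphXn !mulrA.
pose zeta := expi_node (K := node_count n) (node_shift c).
have f_rep : reproduced n zeta (freq_a n) (freq_b n) (freq_c n) f.
  apply: reproduced_sum => m /msize_mdeg_lt lem; apply: reproducedZ.
  apply: reproduced_cosz.
  - exact: norm_expi_node.
  - exact: expi_node_sum.
  - exact: freq_alias_free.
  move: (leq_trans lem degp).
  by rewrite ltnS mdegE !big_ord_recl big_ord0 addn0 addnA.
have zetaE s (k : nat) : zeta s ^ k = expi (k%:R * node_angle c n s).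
  by rewrite expiMn.
have [L1 L2 _] := trunc_log_bounds n.
have normC (x : R) : `|x%:C| = `|x|%:C.
  by rewrite normc_def /= expr0n addr0 sqrtr_sqr.
have := @lebesgue_bound _ n _ zeta _ _ _ (norm_expi_node _)
  (@expi_node_sum R _ _) (freq_alias_free n0) _ M%:C f
  (expi t1) (expi t2) (expi t3) isT L1 L2 f_rep.
rewrite fE normC !norm_expi ler0c => /(_ M0) bound.
rewrite -lecR; apply: le_trans (bound _ erefl erefl erefl) _.
  by move=> s; rewrite !zetaE fE normC lecR; apply: pM; apply: node_in_mesh.
by rewrite /lebesgue_const 2!rmorphM rmorphXn rmorphM !rmorph_nat.
Qed.

(** * Sup norms on the cube, cardinality and growth *)

Lemma cube_cos_row x : cube x -> exists t1 t2 t3, x = cos_row t1 t2 t3.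
Proof.
move=> cx; exists (acos (x ord0 0)), (acos (x ord0 1)), (acos (x ord0 (1 + 1))).
by apply/rowP => -[[|[|[|//]]] lt3]; rewrite mxE /= acosK ?in_itv /= ?cx //;
   congr (x _ _); apply: val_inj.
Qed.

Lemma cos_row_cube t1 t2 t3 : cube (cos_row t1 t2 t3).
Proof. by move=> [[|[|[|//]]] lt3]; rewrite mxE /= cos_geN1 cos_le1. Qed.

Lemma mesh_sub_cube c n : [set` lissajous_mesh c n] `<=` @cube R.
Proof. by move=> x /= /imfsetP[s _ ->]; apply: cos_row_cube. Qed.

Lemma compact_cube : compact (@cube R).
Proof.
have := @rV_compact R 3 (fun=> `[(-1), 1]%classic)
  (fun=> @segment_compact R _ _).
by congr compact; apply/seteqP; split=> x /= cx i; move: (cx i);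
  rewrite /= in_itv.
Qed.

Lemma ler_sup_norm_fset (A : {fset 'rV[R]_3}) (g : 'rV[R]_3 -> R) x :
  x \in A -> `|g x| <= sup_norm [set` A] g.
Proof.
move=> xA; apply: ub_le_sup; last by exists x.
exists (\sum_(y <- A) `|g y|) => _ [y /= yA <-].
by rewrite (big_rem y) //= lerDl sumr_ge0.
Qed.

Lemma mesh_sup_norm c n (p : mpoly 3 R) : (0 < n)%N -> total_degree_le n p ->
  sup_norm cube (peval p) <=
    lebesgue_const n * sup_norm [set` lissajous_mesh c n] (peval p).
Proof.
move=> n0 degp.
have le_mesh := @ler_sup_norm_fset (lissajous_mesh c n) (peval p).
apply: ge_sup => [|_ [x /cube_cos_row [t1 [t2 [t3 ->]]] <-]].
  by exists `|peval p (cos_row 0 0 0)|; exists (cos_row 0 0 0) => //;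
    apply: cos_row_cube.
apply: (meval_lebesgue _ _ _ n0 degp _ le_mesh).
(* The node of index 0 lies in the mesh, so the sup norm on the mesh is nonnegative. *)
apply: le_trans (le_mesh _ (node_in_mesh c (isT : (0 < node_count n)%N))).
exact: normr_ge0.
Qed.

(** There are at most nu + 2 <= 4 n ^ 3 + n + 2 sampling angles, and 4 + 1 + 2 = 7. *)
Lemma card_mesh c n : (0 < n)%N ->
  (#|` lissajous_mesh (R := R) c n| <= 7 * n ^ 3)%N.
Proof.
move=> n0; apply: leq_trans (leq_imfset_card _ _ _) _.
rewrite /= -cardE card_ord; have [la lb lc] := freq_le n.
have le_mu : (mu c n <= (nu n).+1)%N by case: c => //=.
have le_nu : (nu n <= n * (4 * n ^ 2 + 1))%N.
  by rewrite /nu leq_mul2l; apply/orP; right; lia.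
have n3 : (n * n <= n * n * n)%N by rewrite leq_pmulr.
have n2 : (n <= n * n)%N by rewrite leq_pmulr.
by move: le_nu; rewrite !expnS expn0; lia.
Qed.

Lemma lebesgue_const_ge0 n : 0 <= lebesgue_const n.
Proof. by rewrite mulr_ge0 ?exprn_ge0 ?mulr_ge0 ?ler0n. Qed.

Lemma lebesgue_const_poly : at_most_polynomial lebesgue_const.
Proof.
(* From L + 1 <= 2 ^ L <= n %/ 3 + 1 <= 2n follows 24 (L + 1) <= 48 n. *)
exists (64 * 48 ^+ 3), 3 => n n0; rewrite /lebesgue_const -mulrA ler_pM2l
  ?ltr0n //.
rewrite -exprMn lerXn2r ?nnegrE ?mulr_ge0 ?ler0n //.
have [_ _ leL] := trunc_log_bounds n.
have := ltn_expl (trunc_log 2 (n %/ 3).+1) (isT : 1 < 2)%N => ltL.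
by rewrite -!natrM ler_nat; lia.
Qed.

Lemma lebesgue_const_log :
  (lebesgue_const : nat -> R^o) =O_\oo (fun n => (ln n%:R ^+ 3 : R^o)).
Proof.
have ln2 : 0 < ln 2 :> R by rewrite ln_gt0 ?ltr1n.
(* For n >= 2 both L ln 2 and ln 2 are at most ln n, so 24 (L + 1) <= 48 ln n / ln 2. *)
apply/eqO_exP; exists (64 * (48 / ln 2) ^+ 3).
  by rewrite mulr_gt0 ?exprn_gt0 ?divr_gt0 ?ltr0n.
exists 2%N => // n /= n2.
have n0 : 0 < n%:R :> R by rewrite ltr0n; lia.
have ln_n : ln 2 <= ln n%:R :> R by rewrite ler_ln ?posrE ?ler_nat.
have ln_n0 : 0 <= ln n%:R :> R := le_trans (ltW ln2) ln_n.
have ln2V : 0 <= (ln 2)^-1 :> R by rewrite invr_ge0 ltW.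
rewrite ger0_norm ?lebesgue_const_ge0 // ger0_norm ?exprn_ge0 //.
rewrite /lebesgue_const -mulrA ler_pM2l ?ltr0n // -exprMn.
rewrite lerXn2r ?nnegrE ?mulr_ge0 ?ler0n //.
have [_ _ leL] := trunc_log_bounds n.
set L := trunc_log _ _ in leL *.
have lnL : L%:R * ln 2 <= ln n%:R :> R.
  have le_n : 2 ^+ L <= n%:R :> R by rewrite -natrX ler_nat; lia.
  by rewrite mulr_natl -lnXn ?ltr0n // ler_ln ?posrE // exprn_gt0 ?ltr0n.
by rewrite mulrAC ler_pdivlMr // -natr1; lra.
Qed.

End LissajousNodes.

(** * Polynomials vanishing on the cube *)

Section CubeDetermining.
Variable R : realType.

Lemma digit_inj (N a b x y : nat) : (a < N)%N -> (b < N)%N ->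
  (a + N * x = b + N * y)%N -> a = b /\ x = y.
Proof.
move=> ltaN ltbN; rewrite ![(N * _)%N]mulnC ![(_ + _ * N)%N]addnC.
by move=> /(congr1 (edivn^~ N)); rewrite !edivn_eq // => -[].
Qed.

Lemma poly_unit_interval_eq0 (q : {poly R}) :
  (forall t, 0 <= t <= 1 -> q.[t] = 0) -> q = 0.
Proof.
move=> q0; apply/eqP/negP => /negP qN0.
(* The points 1 / (j + 1) for j < [size q] are distinct roots, one more than the degree allows. *)
have := @max_poly_roots _ q [seq j.+1%:R^-1 | j <- iota 0 (size q)] qN0.
rewrite size_map size_iota ltnn map_inj_uniq ?iota_uniq; last first.
  by move=> i j /invr_inj /eqP; rewrite eqr_nat => /eqP [].
suff -> : all (root q) [seq j.+1%:R^-1 | j <- iota 0 (size q)].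
  by move=> /(_ isT isT).
apply/allP => _ /mapP[j _ ->]; apply/rootP/q0.
by rewrite invr_ge0 ler0n invf_le1 ?ltr0n // ler1n.
Qed.

(* Kronecker substitution: x_i = t ^ (N ^ i) sends distinct monomials with
   exponents below N to distinct powers of t. *)
Lemma cube_determining : polynomial_determining (@cube R).
Proof.
move=> p p0; set N := msize p.
pose i0 : 'I_3 := ord0; pose i1 : 'I_3 := lift ord0 ord0.
pose i2 : 'I_3 := lift ord0 (lift ord0 ord0).
pose key (m : multinom 3) := (m i0 + N * (m i1 + N * m i2))%N.
have lt_N (m : multinom 3) i : m \in msupp p -> (m i < N)%N.
  move=> /msize_mdeg_lt; apply: leq_ltn_trans.
  by rewrite mdegE (bigD1 i) //= leq_addr.
have key_inj : {in msupp p &, injective key}.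
  move=> m m' mp mp' /(digit_inj (lt_N _ _ mp) (lt_N _ _ mp')) [e0].
  move=> /(digit_inj (lt_N _ _ mp) (lt_N _ _ mp')) [e1 e2].
  apply/mnmP => i; have : i \in [:: i0; i1; i2] by case: i => -[|[|[|//]]] lti.
  by rewrite !inE => /or3P[] /eqP->.
pose q : {poly R} := \sum_(m <- msupp p) mcoeff m p *: 'X^(key m).
have q0 : q = 0.
  apply: poly_unit_interval_eq0 => t t01.
  pose x : 'rV[R]_3 := \row_(i < 3) t ^+ (N ^ i).
  rewrite -(p0 x) => [|i]; last first.
    have /andP[t0 t1] := t01.
    by rewrite mxE exprn_ile1 // (le_trans _ (exprn_ge0 _ t0)) // lerN10.
  rewrite /peval mevalE horner_sum; apply: eq_bigr => m _.
  rewrite hornerZ hornerXn !big_ord_recl big_ord0 !mxE mulr1 -!exprM -!exprD.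
  by congr (_ * _ ^+ _); rewrite /key /bump /=; ring.
apply/mpolyP => m; rewrite mcoeff0; have [mp|mNp] := boolP (m \in msupp p);
  last first.
  exact: memN_msupp_eq0.
have := congr1 (fun r : {poly R} => r`_(key m)) q0;
  rewrite coef0 coef_sum => <-.
rewrite (bigD1_seq m) //= ?msupp_uniq // coefZ coefXn eqxx mulr1 big_seq_cond
  big1 ?addr0 // => m' /andP[m'p m'Nm].
rewrite coefZ coefXn; case: eqP => [/(key_inj _ _ mp m'p) e|_];
  last by rewrite mulr0.
by rewrite e eqxx in m'Nm.
Qed.
End CubeDetermining.

Theorem mainTheorem5 (R : realType) (c : sampling) :
  exists C : nat -> R,
    is_WAM cube (lissajous_mesh c) C /\
    (C : nat -> R^o) =O_\oo (fun n => (ln n%:R ^+ 3 : R^o)).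
Proof.
exists (@lebesgue_const R); split; last exact: lebesgue_const_log.
split.
- exact: compact_cube.
- exact: cube_determining.
- by move=> n _; apply: mesh_sub_cube.
- by move=> n n0 p; apply: mesh_sup_norm.
- exact: lebesgue_const_poly.
- exists 7, 3%N => n n0; rewrite -natrX -natrM ler_nat; exact: card_mesh.
Qed.
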